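(* Consider an online $k$-nearest-neighbor search over $n$ data points of dimension $d$ whose dimensions are split into $M$ partitions, with online time complexity $$O\bigl(d+Mn+n\log k+\beta A\alpha^{M}nd+\beta A\alpha^{M}n\log k\bigr),$$ where $A$, $\alpha$ ($0<\alpha<1$) and $\beta$ are the constants of the cost model. For any user-specified $k$ $(0<k\le n)$, this time complexity can be minimized by setting the number of partitions $$M=\log_{\alpha}\frac{2n}{-\mu\ln\alpha\,(d+\log k)},$$ where $\mu=\beta A n$.
   Context: The cost model concerns $k$-nearest-neighbor search with a Bregman distance, where the $d$ dimensions are partitioned into $M$ subspaces and an upper bound on the distance between the query and each data point is obtained by summing bounds from the $M$ subspaces. The upper bound is modelled as depending exponentially on $M$: $UB=A\alpha^{M}$ with $0<\alpha<1$. The pruning effect of the search bound is described by a parameter $\lambda$ $(0<\lambda<1)$, assumed proportional to the upper bound, $\lambda=\beta\,UB$, so that the number of candidate points is estimated as $\beta A\alpha^{M}n$. The contributions to the time complexity are: $O(d)$ for transforming the query point; $O(Mn)$ for computing the upper bounds of the $n$ points in all $M$ subspaces, and also $O(Mn)$ for summing them up; $O(n\log k)$ for finding the $k$-th smallest upper bound; $O(\beta A\alpha^{M}nd)$ for computing the Bregman distances between the candidate points and the query; and $O(\beta A\alpha^{M}n\log k)$ for evaluating the $k$ nearest neighbors among the candidates. The time for searching the index trees is ignored. The value of $M$ given by the formula may not be an integer; in practice the time costs for rounding up and rounding down are compared and the better value is chosen. *)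

(* Defs.v *)
From Stdlib Require Import Reals.
Open Scope R_scope.

(* Cost model of online k-nearest-neighbour search over n points of dimension d,
   with the dimensions split into M partitions. M is a real variable, as the
   optimum need not be an integer. The base b of the logarithm in the k-dependent
   costs is a parameter, since the O-notation leaves it unspecified. *)

Definition upper_bound (A alpha M : R) : R := A * Rpower alpha M.

Definition pruning (A alpha beta M : R) : R := beta * upper_bound A alpha M.

Definition candidates (A alpha beta : R) (n : nat) (M : R) : R :=
  pruning A alpha beta M * INR n.

Definition query_transform_cost (d : nat) : R := INR d.

Definition bound_computation_cost (n : nat) (M : R) : R := M * INR n.

Definition bound_summation_cost (n : nat) (M : R) : R := M * INR n.

Definition kth_bound_cost (b : R) (n k : nat) : R := INR n * Rlog b (INR k).

Definition candidate_distance_cost (A alpha beta : R) (d n : nat) (M : R) : R :=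
  candidates A alpha beta n M * INR d.

Definition candidate_selection_cost (A alpha beta b : R) (n k : nat) (M : R) : R :=
  candidates A alpha beta n M * Rlog b (INR k).

(* Each contribution has unit constant. Computing the bounds and summing them
   cost M n each, whence the 2 n in the optimal number of partitions. *)
Definition online_cost (A alpha beta b : R) (d n k : nat) (M : R) : R :=
  query_transform_cost d
  + bound_computation_cost n M
  + bound_summation_cost n M
  + kth_bound_cost b n k
  + candidate_distance_cost A alpha beta d n M
  + candidate_selection_cost A alpha beta b n k M.

Definition optimal_partitions (A alpha beta b : R) (d n k : nat) : R :=
  let mu := beta * A * INR n in
  Rlog alpha (2 * INR n / (- mu * ln alpha * (INR d + Rlog b (INR k)))).

(* Main.v *)
(* With c = - ln alpha and t = (M - M0) ln alpha, where M0 is the stationary point,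
   the cost at M exceeds the cost at M0 by (2 n / c) (exp t - 1 - t), which is
   nonnegative. *)
Require Import Defs.
From Stdlib Require Import Reals Lra Lia.
Open Scope R_scope.

(** As a function of [M] the cost is a constant plus [p * M + q * Rpower alpha M], with [p = 2 n]
    and [q = mu (d + log k)] both positive ([online_cost_eq]). This is convex, and its stationary
    point is the stated number of partitions. Global minimality needs no calculus: the tangent-line
    inequality [1 + t <= exp t] suffices ([linear_plus_Rpower_min]). The asymptotic bound compares
    nonnegative terms one by one. *)

Lemma ln_neg (a : R) : 0 < a < 1 -> ln a < 0.
Proof.
intros [Ha0 Ha1]. rewrite <- ln_1. now apply ln_increasing.
Qed.

Lemma Rlog_INR_nonneg (b : R) (k : nat) : 1 < b -> (0 < k)%nat -> 0 <= Rlog b (INR k).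
Proof.
intros Hb Hk.
assert (Hlnb : 0 < ln b) by (rewrite <- ln_1; apply ln_increasing; lra).
assert (Hk1 : 1 <= INR k) by (apply (le_INR 1); lia).
assert (Hlnk : 0 <= ln (INR k)).
{ rewrite <- ln_1. destruct Hk1 as [Hlt | <-]; [left; apply ln_increasing |]; lra. }
unfold Rlog.
apply Rmult_le_pos; [exact Hlnk | left; now apply Rinv_0_lt_compat].
Qed.

Lemma Rpower_Rlog_lt1 (a x : R) : 0 < a < 1 -> 0 < x -> Rpower a (Rlog a x) = x.
Proof.
intros Ha Hx. pose proof (ln_neg a Ha).
unfold Rpower, Rlog.
replace (ln x / ln a * ln a) with (ln x) by (field; lra).
now apply exp_ln.
Qed.

(** [M0] is the zero of the derivative [p + q * ln a * Rpower a M]; the quotient inside the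
    logarithm is positive because [ln a < 0]. *)
Lemma linear_plus_Rpower_min (a p q M : R) :
  0 < a < 1 -> 0 < p -> 0 < q ->
  let M0 := Rlog a (p / (- ln a * q)) in
  p * M0 + q * Rpower a M0 <= p * M + q * Rpower a M.
Proof.
intros Ha Hp Hq M0.
pose proof (ln_neg a Ha) as Hln.
assert (Hx : 0 < p / (- ln a * q)).
{ apply Rdiv_lt_0_compat; [lra | apply Rmult_lt_0_compat; lra]. }
assert (HM0 : Rpower a M0 = p / (- ln a * q)) by now apply Rpower_Rlog_lt1.
assert (HM : Rpower a M = Rpower a M0 * exp ((M - M0) * ln a)).
{ unfold Rpower. rewrite <- exp_plus. f_equal. ring. }
rewrite HM, HM0.
pose proof (exp_ineq1_le ((M - M0) * ln a)) as Hexp.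
set (t := (M - M0) * ln a) in *.
(* At [M0] the exponential term equals [p / - ln a], and [p * (M - M0)] is [- t] times the same
   factor, so the factor comes out of the whole gap. *)
assert (Hgap : p * M + q * (p / (- ln a * q) * exp t)
               - (p * M0 + q * (p / (- ln a * q)))
               = p / - ln a * (exp t - (1 + t))).
{ unfold t. field. lra. }
assert (0 <= p / - ln a * (exp t - (1 + t))).
{ apply Rmult_le_pos; [left; apply Rdiv_lt_0_compat |]; lra. }
lra.
Qed.

Lemma online_cost_eq (A alpha beta b : R) (d n k : nat) (M : R) :
  online_cost A alpha beta b d n k M =
  INR d + INR n * Rlog b (INR k)
  + (2 * INR n * M
     + beta * A * INR n * (INR d + Rlog b (INR k)) * Rpower alpha M).
Proof.
unfold online_cost, query_transform_cost, bound_computation_cost,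
  bound_summation_cost, kth_bound_cost, candidate_distance_cost,
  candidate_selection_cost, candidates, pruning, upper_bound.
ring.
Qed.

Theorem theorem4 :
  forall A alpha beta b : R,
    0 < alpha < 1 ->
    0 < beta * A ->
    1 < b ->
    (exists C : R, 0 < C /\
      forall (d n k : nat) (M : R),
        (1 <= d)%nat -> (0 < k <= n)%nat -> 0 <= M ->
        online_cost A alpha beta b d n k M <=
          C * (INR d + M * INR n + INR n * Rlog b (INR k)
               + beta * A * Rpower alpha M * INR n * INR d
               + beta * A * Rpower alpha M * INR n * Rlog b (INR k)))
    /\
    (forall d n k : nat,
        (1 <= d)%nat -> (0 < k <= n)%nat ->
        forall M : R,
          online_cost A alpha beta b d n k (optimal_partitions A alpha beta b d n k)
          <= online_cost A alpha beta b d n k M).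
Proof.
intros A alpha beta b Halpha HbetaA Hb. split.
(* The factor 2 absorbs the two costs [M n], for computing and for summing the bounds; every other
   term occurs once. *)
- exists 2. split; [lra |].
  intros d n k M Hd Hk HM. rewrite online_cost_eq.
  assert (Hlog : 0 <= Rlog b (INR k)) by (apply Rlog_INR_nonneg; [exact Hb | lia]).
  pose proof (pos_INR d) as Hd0. pose proof (pos_INR n) as Hn0.
  assert (Hpow : 0 < Rpower alpha M) by apply exp_pos.
  assert (0 <= INR n * Rlog b (INR k)) by now apply Rmult_le_pos.
  assert (0 <= beta * A * Rpower alpha M * INR n).
  { apply Rmult_le_pos; [apply Rmult_le_pos |]; lra. }
  assert (0 <= beta * A * Rpower alpha M * INR n * INR d) by now apply Rmult_le_pos.
  assert (0 <= beta * A * Rpower alpha M * INR n * Rlog b (INR k))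
    by now apply Rmult_le_pos.
  lra.
- intros d n k Hd Hk M. rewrite !online_cost_eq.
  assert (Hlog : 0 <= Rlog b (INR k)) by (apply Rlog_INR_nonneg; [exact Hb | lia]).
  (* Strictness matters: at [k = 1] the logarithm vanishes, and [d] alone keeps [q] positive. *)
  assert (Hd0 : 0 < INR d) by (apply lt_0_INR; lia).
  assert (Hn0 : 0 < INR n) by (apply lt_0_INR; lia).
  apply Rplus_le_compat_l.
  unfold optimal_partitions; cbv zeta.
  (* Regroups the denominator as [- ln alpha * q]. *)
  replace (- (beta * A * INR n) * ln alpha * (INR d + Rlog b (INR k)))
    with (- ln alpha * (beta * A * INR n * (INR d + Rlog b (INR k)))) by ring.
  apply linear_plus_Rpower_min; [exact Halpha | lra |].
  apply Rmult_lt_0_compat; [now apply Rmult_lt_0_compat | lra].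
Qed.
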